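(* (Semi-discrete Reynolds transport theorem.) For any two differentiable vector functions $\boldsymbol\Phi(t),\boldsymbol\Psi(t)\in\mathbb{R}^{n_V}$ with surface restrictions $\Phi=E\boldsymbol\Phi$, $\Psi=E\boldsymbol\Psi$, $$\frac{d}{dt}\big(\boldsymbol\Phi,\boldsymbol\Psi\big)_{\mathcal{P}}=\big(\boldsymbol\Phi_t,\boldsymbol\Psi\big)_{\mathcal{P}}+\big(\boldsymbol\Phi,\boldsymbol\Psi_t\big)_{\mathcal{P}}+\big(\Phi,\big(\underline{N^T\dot X}\big)\Psi\big)_P .$$
   Context: Notation: for a vector $\boldsymbol v$, $\underline{\boldsymbol v}=\mathrm{Diag}(\boldsymbol v)$. A moving volume mesh has $n_V$ nodes, a subset of $n_S$ of which are the surface nodes; $E$ is the $n_S\times n_V$ restriction matrix to surface nodes (each row has a single nonzero entry, equal to $1$, distinct rows selecting distinct nodes). $\mathcal{P}=\mathcal{P}(t)\in\mathbb{R}^{n_V}$ (positive entries) and $P=P(t)\in\mathbb{R}^{n_S}$ are volume and surface quadrature weights, and $(\boldsymbol\Phi,\boldsymbol\Psi)_{\mathcal{P}}=\boldsymbol\Phi^T\underline{\mathcal{P}}\boldsymbol\Psi$, $(\Phi,\Psi)_P=\Phi^T\underline{P}\Psi$. For $i=1,\dots,p$, $\mathcal{D}_{x_i}$ are $n_V\times n_V$ matrices satisfying the summation-by-parts property $\mathcal{D}_{x_i}=\underline{\mathcal{P}}^{-1}\mathcal{Q}_{x_i}$, $\mathcal{Q}_{x_i}+\mathcal{Q}_{x_i}^T=E^T\underline{P}\,\underline{N}_iE$,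 with $N_i\in\mathbb{R}^{n_S}$ the surface node values of the $i$-th normal component. $\dot{\boldsymbol X}_i\in\mathbb{R}^{n_V}$ contains nodal values of the mesh velocity component $\dot x_i$, $\dot X_i=E\dot{\boldsymbol X}_i$, and $\underline{N^T\dot X}=\sum_{i=1}^p\underline{N}_i\,\underline{\dot X}_i$. Define $\mathcal{D}_m=\frac12\sum_{i=1}^p(\underline{\dot{\boldsymbol X}}_i\mathcal{D}_{x_i}+\mathcal{D}_{x_i}\underline{\dot{\boldsymbol X}}_i)$, and let $\boldsymbol\nabla\cdot\dot{\boldsymbol X}\in\mathbb{R}^{n_V}$ be a vector of exact or approximated nodal values of $\nabla\cdot\dot x$. The discrete partial time derivative of a differentiable $\boldsymbol\Phi(t)$ is $$\boldsymbol\Phi_t=\frac{d\boldsymbol\Phi}{dt}-\Big(\mathcal{D}_m-\tfrac12\underline{\boldsymbol\nabla\cdot\dot{\boldsymbol X}}\Big)\boldsymbol\Phi .$$ It is assumed that $\mathcal{P}(t)=\underline{\mathcal{J}(t)}\hat{\mathcal{P}}$ where $\hat{\mathcal{P}}$ is constant in time and $\mathcal{J}(t)\in\mathbb{R}^{n_V}$ is entrywise positive and satisfies $\frac{d\mathcal{J}}{dt}=\big(\underline{\boldsymbol\nabla\cdot\dot{\boldsymbol X}}\big)\mathcal{J}$, $\mathcal{J}(t_0)=\mathcal{J}_0>0$, with the same vector $\boldsymbol\nabla\cdot\dot{\boldsymbol X}$. *)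

(* Defs.v *)
From HB Require Import structures.
From mathcomp Require Import all_boot all_order all_algebra.
From mathcomp Require Import boolp classical_sets functions reals topology.
From mathcomp Require Import normedtype derive.
Set Implicit Arguments.
Unset Strict Implicit.
Unset Printing Implicit Defensive.
Import Order.TTheory GRing.Theory Num.Theory.
Import numFieldNormedType.Exports.
Local Open Scope classical_set_scope.
Local Open Scope ring_scope.

(* Nodal vectors are column vectors, whereas [diag_mx] expects a row. *)
Definition Diag (R : realType) (n : nat) (v : 'cV[R]_n) : 'M[R]_n :=
  diag_mx v^T.

(* The 1 x 1 matrix v^T Diag(w) u is read as a scalar. *)
Definition wip (R : realType) (n : nat) (w v u : 'cV[R]_n) : R :=
  (v^T *m Diag w *m u) 0 0.

Definition entrywise_pos (R : realType) (n : nat) (v : 'cV[R]_n) : Prop :=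
  forall k, 0 < v k 0.

(* Row k of E selects the volume node s k. *)
Definition restriction_mx (R : realType) (nS nV : nat)
    (E : 'M[R]_(nS, nV)) : Prop :=
  exists2 s : 'I_nS -> 'I_nV,
    injective s & forall k l, E k l = (l == s k)%:R.

(* Summation by parts for one space direction at one instant, with volume
   weights w, surface weights ws and normal component N. *)
Definition sbp (R : realType) (nS nV : nat) (E : 'M[R]_(nS, nV))
    (w : 'cV[R]_nV) (ws N : 'cV[R]_nS) (D Q : 'M[R]_nV) : Prop :=
  D = invmx (Diag w) *m Q /\ Q + Q^T = E^T *m Diag ws *m Diag N *m E.

Definition mesh_convection (R : realType) (p nV : nat)
    (D : 'I_p -> 'M[R]_nV) (V : 'I_p -> 'cV[R]_nV) : 'M[R]_nV :=
  2^-1 *: \sum_(i < p) (Diag (V i) *m D i + D i *m Diag (V i)).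

Definition normal_velocity_mx (R : realType) (p nS nV : nat)
    (E : 'M[R]_(nS, nV)) (N : 'I_p -> 'cV[R]_nS) (V : 'I_p -> 'cV[R]_nV) :
    'M[R]_nS :=
  \sum_(i < p) Diag (N i) *m Diag (E *m V i).

Definition discrete_time_derivative (R : realType) (p nV : nat)
    (D : 'I_p -> R -> 'M[R]_nV) (V : 'I_p -> R -> 'cV[R]_nV)
    (divV : R -> 'cV[R]_nV) (Phi : R -> 'cV[R]_nV) (t : R) : 'cV[R]_nV :=
  derive1 Phi t
  - (mesh_convection (fun i => D i t) (fun i => V i t)
     - 2^-1 *: Diag (divV t)) *m Phi t.

(* Main.v *)
(* With W = Diag(P) and B = D_m, summation by parts makes W B skew up to the
   boundary term: W B + B^T W = E^T Diag(Ps) Diag(N^T Xdot) E.  The weights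
   inherit P' = Diag(div Xdot) P from the equation for J, so in the product rule
   the term Phi^T W' Psi is exactly what the two corrections
   - (D_m - Diag(div Xdot)/2) in the discrete time derivatives leave over, up to
   that boundary term. *)
Require Import Defs.
From HB Require Import structures.
From mathcomp Require Import all_boot all_order all_algebra.
From mathcomp Require Import boolp classical_sets functions reals topology.
From mathcomp Require Import normedtype derive.
From mathcomp Require Import ring.
Set Implicit Arguments.
Unset Strict Implicit.
Unset Printing Implicit Defensive.
Import Order.TTheory GRing.Theory Num.Theory.
Import numFieldNormedType.Exports.
Local Open Scope classical_set_scope.
Local Open Scope ring_scope.

Lemma trmx_Diag (R : realType) (n : nat) (v : 'cV[R]_n) : (Diag v)^T = Diag v.
Proof. exact: tr_diag_mx. Qed.

Lemma mul_Diag_mx (R : realType) (m n : nat) (v : 'cV[R]_m) (A : 'M[R]_(m, n)) :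
  Diag v *m A = \matrix_(i, j) (v i 0 * A i j).
Proof. by apply/matrixP => i j; rewrite mul_diag_mx !mxE. Qed.

Lemma mul_mx_Diag (R : realType) (m n : nat) (A : 'M[R]_(m, n)) (v : 'cV[R]_n) :
  A *m Diag v = \matrix_(i, j) (A i j * v j 0).
Proof. by apply/matrixP => i j; rewrite mul_mx_diag !mxE. Qed.

Lemma Diag_comm (R : realType) (n : nat) (v w : 'cV[R]_n) :
  Diag v *m Diag w = Diag w *m Diag v.
Proof. exact: diag_mxC. Qed.

Lemma Diag_unit (R : realType) (n : nat) (w : 'cV[R]_n) :
  entrywise_pos w -> Diag w \in unitmx.
Proof.
move=> w_pos; rewrite unitmxE det_diag unitfE prodf_seq_neq0.
by apply/allP => i _ /=; rewrite mxE gt_eqF.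
Qed.

Lemma wipE (R : realType) (n : nat) (w v u : 'cV[R]_n) :
  wip w v u = \sum_k w k 0 * v k 0 * u k 0.
Proof.
rewrite /wip mxE; apply: eq_bigr => k _.
by rewrite mul_mx_Diag !mxE (mulrC (v k 0)).
Qed.

Lemma wipBl (R : realType) (n : nat) (w v v' u : 'cV[R]_n) :
  wip w (v - v') u = wip w v u - wip w v' u.
Proof. by rewrite /wip linearB /= !mulmxBl !mxE. Qed.

Lemma wipBr (R : realType) (n : nat) (w v u u' : 'cV[R]_n) :
  wip w v (u - u') = wip w v u - wip w v u'.
Proof. by rewrite /wip mulmxBr !mxE. Qed.

(** Row k of [E] is the unit row at [s k], so on both sides row k has its only possibly nonzero
    entry, the value of [v] at node [s k], in column [s k]. This carries the mesh velocity from
    volume nodes to surface nodes. *)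
Lemma restriction_Diag (R : realType) (nS nV : nat) (E : 'M[R]_(nS, nV))
    (v : 'cV[R]_nV) :
  restriction_mx E -> E *m Diag v = Diag (E *m v) *m E.
Proof.
case=> s _ Es; apply/matrixP => k l; rewrite mul_mx_Diag mul_Diag_mx !mxE.
rewrite (bigD1 (s k)) //= big1 => [|i /negPf i_sk]; last first.
  by rewrite Es i_sk mul0r.
rewrite !Es eqxx mul1r addr0; have [->|_] := eqVneq l (s k).
  by rewrite mul1r mulr1.
by rewrite mul0r mulr0.
Qed.

Lemma mesh_convection_sbp (R : realType) (p nV nS : nat)
    (E : 'M[R]_(nS, nV)) (w : 'cV[R]_nV) (ws : 'cV[R]_nS)
    (N : 'I_p -> 'cV[R]_nS) (D Q : 'I_p -> 'M[R]_nV) (V : 'I_p -> 'cV[R]_nV) :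
  restriction_mx E -> entrywise_pos w ->
  (forall i, sbp E w ws (N i) (D i) (Q i)) ->
  Diag w *m mesh_convection D V + (mesh_convection D V)^T *m Diag w =
    E^T *m Diag ws *m normal_velocity_mx E N V *m E.
Proof.
move=> E_restr w_pos D_sbp; rewrite /mesh_convection /normal_velocity_mx.
(* With W = [Diag w] symmetric, B^T W = (W B)^T, so only W B has to be computed, one direction at a
   time. *)
rewrite -{2}(trmx_Diag w) -trmx_mul -scalemxAr linearZ /= -scalerDr.
rewrite !mulmx_sumr mulmx_suml raddf_sum -big_split /= scaler_sumr.
apply: eq_bigr => i _; have [-> QE] := D_sbp i.
have -> : Diag w *m (Diag (V i) *m (invmx (Diag w) *m Q i)
                     + invmx (Diag w) *m Q i *m Diag (V i))
        = Diag (V i) *m Q i + Q i *m Diag (V i).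
  have wQ : Diag w *m (invmx (Diag w) *m Q i) = Q i.
    by rewrite mulKVmx // Diag_unit.
  rewrite mulmxDr; congr (_ + _); last by rewrite mulmxA wQ.
  by rewrite mulmxA Diag_comm -mulmxA wQ.
(* With X = [Diag (V i)], the sum regroups as X (Q + Q^T) + (Q + Q^T) X, and summation by parts
   applies to each bracket. *)
rewrite [(_ + _)^T]linearD /= !trmx_mul !trmx_Diag [(Q i)^T *m _ + _]addrC addrACA.
rewrite -mulmxDr -mulmxDl QE.
have EV := restriction_Diag (V i) E_restr.
have VE : Diag (V i) *m E^T = E^T *m Diag (E *m V i).
  by rewrite -[LHS]trmxK trmx_mul trmxK trmx_Diag EV trmx_mul trmx_Diag.
(* Moved through [E^T] or [E], X becomes a surface diagonal that commutes with the others. Both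
   terms are then the same boundary matrix, and the two copies cancel the factor 1/2. *)
have -> : Diag (V i) *m (E^T *m Diag ws *m Diag (N i) *m E) =
    E^T *m Diag ws *m (Diag (N i) *m Diag (E *m V i)) *m E.
  rewrite !mulmxA VE -[_ *m Diag ws in LHS]mulmxA [_ *m Diag ws]Diag_comm.
  by rewrite !mulmxA -!(mulmxA (E^T *m _)) [_ *m Diag (N i)]Diag_comm.
rewrite -[_ *m E *m Diag (V i)]mulmxA EV !mulmxA -mulr2n -[_ *m _ *+ 2]scaler_nat scalerA.
by rewrite mulVf ?scale1r // pnatr_eq0.
Qed.

Lemma is_derive_mxE (R : realType) (m n : nat) (M : R -> 'M[R]_(m, n))
    (t : R) (dM : 'M[R]_(m, n)) (i : 'I_m) (j : 'I_n) :
  is_derive t (1 : R) M dM -> is_derive t (1 : R) (fun s => M s i j) (dM i j).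
Proof.
move=> [Md <-]; split; first by move/derivable_mxP : Md; exact.
by rewrite derive_mx // mxE.
Qed.

Lemma is_derive_mx (R : realType) (m n : nat) (M : R -> 'M[R]_(m, n))
    (t : R) (dM : 'M[R]_(m, n)) :
  (forall i j, is_derive t (1 : R) (fun s => M s i j) (dM i j)) ->
  is_derive t (1 : R) M dM.
Proof.
move=> Md; have dM' : derivable M t 1 by apply/derivable_mxP => i j; case: (Md i j).
split=> //; rewrite derive_mx //; apply/matrixP => i j; rewrite mxE.
by case: (Md i j).
Qed.

Lemma is_derive_wip (R : realType) (n : nat) (w v u : R -> 'cV[R]_n) (t : R)
    (dw dv du : 'cV[R]_n) :
  is_derive t (1 : R) w dw -> is_derive t (1 : R) v dv ->
  is_derive t (1 : R) u du ->
  is_derive t (1 : R) (fun s => wip (w s) (v s) (u s))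
    (wip dw (v t) (u t) + wip (w t) dv (u t) + wip (w t) (v t) du).
Proof.
move=> dwt dvt dut.
have -> : (fun s => wip (w s) (v s) (u s)) =
    \sum_(k < n) ((fun s => w s k 0) * (fun s => v s k 0) * (fun s => u s k 0)).
  apply/funext => s; rewrite wipE fct_sumE; exact: eq_bigr.
rewrite !wipE -!big_split /=; apply: is_derive_sum => k.
(* These facts enter the context for instance resolution, which differentiates the triple product in
   [is_derive_eq]. *)
have ? := is_derive_mxE k 0 dwt.
have ? := is_derive_mxE k 0 dvt.
have ? := is_derive_mxE k 0 dut.
apply: is_derive_eq; rewrite /GRing.scale /= !mulrfctE; ring.
Qed.

Theorem mainTheorem5 (R : realType) (p nV nS : nat)
    (I : set R) (I_open : open I) (I_itv : is_interval I)
    (t0 : R) (It0 : I t0)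
    (E : 'M[R]_(nS, nV)) (E_restr : restriction_mx E)
    (Pv : R -> 'cV[R]_nV) (Ps : R -> 'cV[R]_nS)
    (Pv_pos : forall t, I t -> entrywise_pos (Pv t))
    (N : 'I_p -> R -> 'cV[R]_nS)
    (D Q : 'I_p -> R -> 'M[R]_nV)
    (D_sbp : forall i t, I t -> sbp E (Pv t) (Ps t) (N i t) (D i t) (Q i t))
    (Xdot : 'I_p -> R -> 'cV[R]_nV)
    (divX : R -> 'cV[R]_nV)
    (Phat J0 : 'cV[R]_nV) (J : R -> 'cV[R]_nV)
    (Pv_J : forall t, I t -> Pv t = Diag (J t) *m Phat)
    (J_pos : forall t, I t -> entrywise_pos (J t))
    (J_derivable : forall t, I t -> derivable J t 1)
    (J_ode : forall t, I t -> derive1 J t = Diag (divX t) *m J t)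
    (J_init : J t0 = J0) (J0_pos : entrywise_pos J0)
    (Phi Psi : R -> 'cV[R]_nV)
    (Phi_derivable : forall t, I t -> derivable Phi t 1)
    (Psi_derivable : forall t, I t -> derivable Psi t 1) :
  forall t, I t ->
    derivable (fun s => wip (Pv s) (Phi s) (Psi s)) t 1 /\
    derive1 (fun s => wip (Pv s) (Phi s) (Psi s)) t =
      wip (Pv t) (discrete_time_derivative D Xdot divX Phi t) (Psi t)
      + wip (Pv t) (Phi t) (discrete_time_derivative D Xdot divX Psi t)
      + wip (Ps t) (E *m Phi t)
          (normal_velocity_mx E (N^~ t) (Xdot^~ t) *m (E *m Psi t)).
Proof.
move=> t It.
have dPhi : is_derive t (1 : R) Phi (derive1 Phi t).
  by rewrite derive1E; apply/derivableP/Phi_derivable.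
have dPsi : is_derive t (1 : R) Psi (derive1 Psi t).
  by rewrite derive1E; apply/derivableP/Psi_derivable.
have dJ : is_derive t (1 : R) J (Diag (divX t) *m J t).
  by rewrite -J_ode // derive1E; apply/derivableP/J_derivable.
have dPv : is_derive t (1 : R) Pv (Diag (divX t) *m Pv t).
  (* The factorisation of [Pv] holds only on [I]; since [I] is open it holds near t, which suffices
     for the derivative. As [Phat] is constant, each weight satisfies the same linear equation as
     [J]. *)
  apply: (@near_eq_is_derive _ _ _ (fun s => Diag (J s) *m Phat)).
    by apply: filterS (open_nbhs_nbhs (conj I_open It)) => s /Pv_J ->.
  apply: is_derive_mx => k j; rewrite (ord1 j).
  have -> : (fun s => (Diag (J s) *m Phat) k 0) = Phat k 0 \*: (fun s => J s k 0).
    by apply/funext => s; rewrite mul_Diag_mx mxE mulrC.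
  have ? := is_derive_mxE k 0 dJ.
  apply: is_derive_eq; rewrite Pv_J // !mul_Diag_mx !mxE /GRing.scale /=; ring.
have [? dwip] := is_derive_wip dPv dPhi dPsi.
split=> //; rewrite derive1E dwip /discrete_time_derivative.
have := mesh_convection_sbp (fun i => Xdot i t) E_restr (Pv_pos t It)
  (fun i => D_sbp i t It).
set B := mesh_convection _ _; set S := normal_velocity_mx _ _ _ => BS.
clearbody B S.
have W_div : Diag (Diag (divX t) *m Pv t) = Diag (divX t) *m Diag (Pv t).
  by apply/matrixP => k l; rewrite !mul_Diag_mx !mxE mulrnAr.
(* With A = B - Diag(div)/2, the matrix A^T W + W A is the boundary term minus two halves of
   Diag(div) W, and these halves add up to W'. *)
have key : Diag (Diag (divX t) *m Pv t) =
    E^T *m Diag (Ps t) *m S *m E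
    - ((B - 2^-1 *: Diag (divX t))^T *m Diag (Pv t)
       + Diag (Pv t) *m (B - 2^-1 *: Diag (divX t))).
  have -> : (B - 2^-1 *: Diag (divX t))^T = B^T - 2^-1 *: Diag (divX t).
    by rewrite linearB [X in _ - X]linearZ /= trmx_Diag.
  rewrite -BS mulmxBl mulmxBr -scalemxAl -scalemxAr (Diag_comm (Pv t)) W_div.
  rewrite addrACA -opprD -scalerDl [2^-1 + _](_ : _ = 1); last by field.
  by rewrite scale1r [B^T *m _ + _]addrC subKr.
rewrite !wipBl !wipBr.
set A := B - _ in key *.
clearbody A.
(* Every remaining product is put in the form Phi^T M Psi, so that [key] can be used between Phi^T
   and Psi. *)
have -> : wip (Pv t) (A *m Phi t) (Psi t) =
    ((Phi t)^T *m (A^T *m Diag (Pv t)) *m Psi t) 0 0.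
  by rewrite /wip trmx_mul !mulmxA.
have -> : wip (Pv t) (Phi t) (A *m Psi t) =
    ((Phi t)^T *m (Diag (Pv t) *m A) *m Psi t) 0 0.
  by rewrite /wip !mulmxA.
have -> : wip (Ps t) (E *m Phi t) (S *m (E *m Psi t)) =
    ((Phi t)^T *m (E^T *m Diag (Ps t) *m S *m E) *m Psi t) 0 0.
  by rewrite /wip trmx_mul !mulmxA.
(* Stated for abstract matrices so that [mxE] splits the sum without unfolding the matrix
   products. *)
have entryB (X Y Z : 'M[R]_1) :
    (X - (Y + Z)) 0 0 = X 0 0 - (Y 0 0 + Z 0 0) by rewrite !mxE.
rewrite {1}/wip key mulmxBr mulmxBl mulmxDr mulmxDl entryB; ring.
Qed.
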